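(* For the Gaussian half-duplex two-way relay channel with an untrusted relay, with $\bar P_1,\bar P_2>0$ and $h>0$ fixed, let $\mathcal O(\bar P_r)$ be the outer bound and $\mathcal I(\bar P_r)$ the achievable (time-sharing) region of secrecy rate pairs defined in the context. When $\bar P_r\to\infty$, the gap between the outer bound and the achievable rates is bounded by $0.5$ bit per channel use: $$\limsup_{\bar P_r\to\infty}\left(\sup_{(R_1,R_2)\in\mathcal O(\bar P_r)}(R_1+R_2)-\sup_{(R_1,R_2)\in\mathcal I(\bar P_r)}(R_1+R_2)\right)\le 0.5 .$$
   Context: $C(x)=\frac12\log_2(1+x)$, $[x]^+=\max\{x,0\}$; expressions $\beta C(p/\beta)$ at $\beta=0$ are read as $0$. Channel: Nodes 1 and 2 exchange messages $W_1$ (from Node 1) and $W_2$ (from Node 2) via a relay from which both must be kept secret. Each channel use is in MAC mode (a limiting fraction $\alpha$ of uses), where the relay receives $Y_r=X_1+X_2+N$, or in broadcast mode (fraction $1-\alpha$), where Nodes 1, 2 receive $Y_1=\sqrt hX_r+N_1$ and $Y_2=X_r+N_2$; all noises are independent, zero-mean, unit-variance Gaussian. The powers of Nodes 1, 2 and the relay, averaged over all channel uses, are at most $\bar P_1,\bar P_2,\bar P_r$. Rates are in bits per (total) channel use. Outer bound on the secrecy capacity region: $\mathcal O(\bar P_r)$ is the union over $\alpha\in[0,1]$ of the sets of pairs $(R_1,R_2)$ with $R_1,R_2\ge0$, $R_1+R_2\le\alpha\min\{C(\bar P_1/\alpha),C(\bar P_2/\alpha)\}$, $R_1\le(1-\alpha)C(\bar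 P_r/(1-\alpha))$, $R_2\le(1-\alpha)C(h\bar P_r/(1-\alpha))$. Achievable region (compress-and-forward at the relay with cooperative jamming, where Nodes 1 and 2 do not use received signals for encoding): let $$r_1(\bar P_r)=\sup_{0<\alpha<1,\ 0\le P_1'\le\bar P_1/\alpha}\alpha\left[C\left(\frac{P_1'}{1+\sigma_c^2}\right)-C\left(\frac{P_1'}{1+\bar P_2/\alpha}\right)\right]^+,$$ with $\sigma_c^2>0$ determined by $\alpha C\left(\frac{P_1'+1}{\sigma_c^2}\right)=(1-\alpha)C\left(\frac{\bar P_r}{1-\alpha}\right)$. Let $r_2(\bar P_r)$ be the analogous quantity with the roles of Nodes 1 and 2 exchanged, i.e. with $\bar P_1,\bar P_2$ interchanged and $\bar P_r$ replaced by $h\bar P_r$ in the equation determining $\sigma_c^2$. The secrecy rate pairs $(r_1,0)$ and $(0,r_2)$ are achievable, and $\mathcal I(\bar P_r)$ is the convex hull of $\{(0,0),(r_1(\bar P_r),0),(0,r_2(\bar P_r))\}$ obtained by time sharing. *)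

(* Defs.v *)
(* MathComp-Analysis, over an arbitrary R : realType. *)
From mathcomp Require Export all_boot all_order all_algebra.
From mathcomp Require Export all_classical all_reals all_analysis.

Set Implicit Arguments.
Unset Strict Implicit.
Unset Printing Implicit Defensive.

Import Order.TTheory GRing.Theory Num.Theory.
Import numFieldNormedType.Exports.

Local Open Scope classical_set_scope.
Local Open Scope ring_scope.

Definition capacity {R : realType} (x : R) : R := ln (1 + x) / ln 2 / 2.

Definition pos_part {R : realType} (x : R) : R := Num.max x 0.

Definition convex_hull {R : numDomainType} {M : lmodType R} (S : set M) : set M :=
  \bigcap_(A in [set A : set (convex_lmodType M) | convex_set A /\ S `<=` A]) A.

(* A rate pair (R1, R2) is an element of the R-module R^o * R^o.
   Below, P1, P2 and Pr are the average power constraints of Node 1, Node 2 and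
   the relay, h is the power gain of the link from the relay to Node 1, and
   alpha is the fraction of channel uses in MAC mode. *)

(* Since x / 0 = 0, the terms b * capacity (p / b) vanish at b = 0, which is the
   convention for alpha = 0 and alpha = 1. *)
Definition outer_region {R : realType} (P1 P2 h Pr : R) : set (R^o * R^o) :=
  [set r | exists alpha : R,
    [/\ 0 <= alpha <= 1,
        0 <= r.1 /\ 0 <= r.2,
        r.1 + r.2 <=
          alpha * Num.min (capacity (P1 / alpha)) (capacity (P2 / alpha)),
        r.1 <= (1 - alpha) * capacity (Pr / (1 - alpha)) &
        r.2 <= (1 - alpha) * capacity (h * Pr / (1 - alpha))]].

(* Secrecy rates of a source with power budget Ps, the other node jamming with
   power budget Pj, over all choices of alpha and of the source power p in MAC
   mode; s2 is the variance (sigma_c ^ 2) of the compression noise, for a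
   broadcast link from the relay with power times gain Q. *)
Definition cf_rates {R : realType} (Ps Pj Q : R) : set R :=
  [set r | exists alpha p s2 : R,
    [/\ 0 < alpha < 1,
        0 <= p <= Ps / alpha,
        0 < s2,
        alpha * capacity ((p + 1) / s2) =
          (1 - alpha) * capacity (Q / (1 - alpha)) &
        r = alpha * pos_part (capacity (p / (1 + s2)) -
                              capacity (p / (1 + Pj / alpha)))]].

(* For Ps, Pj, Q > 0 the set cf_rates Ps Pj Q contains 0 (take p = 0) and is
   bounded above by Ps / (2 * ln 2), so that sup is its least upper bound. *)
Definition cf_rate {R : realType} (Ps Pj Q : R) : R := sup (cf_rates Ps Pj Q).

Definition inner_region {R : realType} (P1 P2 h Pr : R) : set (R^o * R^o) :=
  let r1 : R := cf_rate P1 P2 Pr in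
  let r2 : R := cf_rate P2 P1 (h * Pr) in
  convex_hull [set (0, 0); (r1, 0); (0, r2)].

Definition sum_rate {R : realType} (S : set (R^o * R^o)) : \bar R :=
  ereal_sup [set (r.1 + r.2)%:E | r in S].

(* Main.v *)
(** Letting alpha tend to 1 and the compression noise tend to 0, node 1 achieves
    every rate below C(P1) - C(P1/(1+P2)) = C(P1) + C(P2) - C(P1+P2), whereas
    the outer bound on the sum rate is at most min(C(P1), C(P2)). The difference
    is C(m/(1+M)), where m and M are the smaller and the larger of P1 and P2,
    and this is strictly less than C(1) = 1/2. Hence one fixed alpha < 1 and one
    fixed bound on the compression noise bring the gap below 1/2, and a large
    relay power attains that noise level. *)
Require Import Defs.
From mathcomp Require Import ring lra.

Set Implicit Arguments.
Unset Strict Implicit.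
Unset Printing Implicit Defensive.

Import Order.TTheory GRing.Theory Num.Theory.
Import numFieldNormedType.Exports.
Local Open Scope classical_set_scope.
Local Open Scope ring_scope.

Lemma ln2_gt0 {R : realType} : 0 < ln 2 :> R.
Proof. by rewrite ln_gt0 // ltr1n. Qed.

Lemma le_capacity {R : realType} (x y : R) :
  0 <= x -> x <= y -> capacity x <= capacity y.
Proof.
move=> x0 xy; rewrite /capacity !ler_pM2r ?invr_gt0 ?ln2_gt0 //.
by rewrite ler_ln ?posrE; lra.
Qed.

Lemma capacity0 {R : realType} : capacity 0 = 0 :> R.
Proof. by rewrite /capacity addr0 ln1 !mul0r. Qed.

Lemma capacity_ge0 {R : realType} (x : R) : 0 <= x -> 0 <= capacity x.
Proof. by move=> x0; rewrite -[X in X <= _]capacity0 le_capacity. Qed.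

Lemma capacity_le_linear {R : realType} (x : R) :
  0 <= x -> capacity x <= x / ln 2 / 2.
Proof.
move=> x0; rewrite /capacity !ler_pM2r ?invr_gt0 ?ln2_gt0 //.
by rewrite le_ln1Dx //; lra.
Qed.

(* ln y <= y - 1 at y = (1 + x/a)/(1 + x) and at y = 1/(1 + x), weighted by a
   and 1 - a, adds up to the claim. *)
Lemma perspective_capacity_le {R : realType} (a x : R) :
  0 <= a <= 1 -> 0 <= x -> a * capacity (x / a) <= capacity x.
Proof.
move=> /andP[a0 a1] x0; have [->|an0] := eqVneq a 0.
  by rewrite mul0r capacity_ge0.
have {an0} a0 : 0 < a by rewrite lt_def an0.
have xa0 : 0 <= x / a by rewrite divr_ge0 // ltW.
rewrite /capacity !mulrA !ler_pM2r ?invr_gt0 ?ln2_gt0 //.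
have G0 : 0 < 1 + x by lra.
have ln_le (y : R) : 0 < y -> ln y <= y - 1.
  by move=> y0; have := @le_ln1Dx R (y - 1); rewrite (addrC 1) subrK; apply; lra.
have h1 := ln_le ((1 + x / a) / (1 + x)) _.
have h2 := ln_le (1 + x)^-1 _.
rewrite ln_div ?posrE in h1; [|lra..].
rewrite lnV ?posrE // in h2.
have {}h1 : ln (1 + x / a) - ln (1 + x) <= (1 + x / a) / (1 + x) - 1.
  by apply: h1; rewrite divr_gt0 //; lra.
have {}h2 : - ln (1 + x) <= (1 + x)^-1 - 1 by apply: h2; rewrite invr_gt0.
have e : a * ((1 + x / a) / (1 + x) - 1) + (1 - a) * ((1 + x)^-1 - 1) = 0.
  by field; rewrite !gt_eqF.
have := ler_wpM2l (ltW a0) h1; have := ler_wpM2l (_ : 0 <= 1 - a) h2.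
by move=> /(_ ltac:(lra)); lra.
Qed.

(** The MAC-mode constraint yields this bound uniformly in [alpha] and [Pr], through
    [perspective_capacity_le] on each term of the minimum. *)
Lemma sum_rate_outer_region_le {R : realType} (P1 P2 h Pr : R) :
  0 <= P1 -> 0 <= P2 ->
  (sum_rate (outer_region P1 P2 h Pr) <=
   (Num.min (capacity P1) (capacity P2))%:E)%E.
Proof.
move=> P10 P20; apply/ereal_supP => _ [r [a [a01 _ rle _ _]] <-].
rewrite lee_fin (le_trans rle) // le_min; have /andP[a0 _] := a01.
apply/andP; split; rewrite (le_trans _ (perspective_capacity_le a01 _)) //;
  by rewrite ler_wpM2l // ge_min lexx ?orbT.
Qed.

(** Since [1 + x <= (1 + s) * (1 + x / (1 + s))] and [ln (1 + s) <= s], the loss due to noise [s] is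
    bounded independently of [x]. *)
Lemma capacity_shrink_ge {R : realType} (x s : R) :
  0 <= x -> 0 <= s -> capacity x - s / ln 2 / 2 <= capacity (x / (1 + s)).
Proof.
move=> x0 s0; rewrite /capacity -!mulrBl !ler_pM2r ?invr_gt0 ?ln2_gt0 //.
have q0 : 0 <= x / (1 + s) by rewrite divr_ge0 //; lra.
have : ln (1 + x) <= ln ((1 + s) * (1 + x / (1 + s))).
  rewrite ler_ln ?posrE ?mulr_gt0 //; [|lra..].
  by rewrite mulrDr mulr1 mulrC divfK ?gt_eqF //; lra.
rewrite lnM ?posrE; [|lra..].
by have := @le_ln1Dx R s ltac:(lra); lra.
Qed.

(** Strictness leaves room for [alpha < 1] and a positive compression noise. *)
Lemma cooperative_jamming_gap {R : realType} (P1 P2 : R) : 0 < P1 -> 0 < P2 ->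
  Num.min (capacity P1) (capacity P2) - 2^-1
    < capacity P1 - capacity (P1 / (1 + P2)).
Proof.
move=> P10 P20.
have q0 : 0 <= P1 / (1 + P2) by rewrite divr_ge0 //; lra.
have half : capacity 1 = 2^-1 :> R.
  by rewrite /capacity divff ?gt_eqF ?ln2_gt0 // mul1r.
have [P12|P21] := leP P1 P2.
  suff : capacity (P1 / (1 + P2)) < 2^-1.
    have : Num.min (capacity P1) (capacity P2) <= capacity P1.
      by rewrite ge_min lexx.
    lra.
  rewrite -half /capacity !ltr_pM2r ?invr_gt0 ?ln2_gt0 //.
  by rewrite ltr_ln ?posrE ?ltrD2l ?ltr_pdivrMr //; lra.
(* The left side is [capacity (P1 + P2)], and [1 + P1 + P2 < 2 * (1 + P1)] because [P2 < P1]. *)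
suff : capacity P2 + capacity (P1 / (1 + P2)) < 2^-1 + capacity P1.
  have : Num.min (capacity P1) (capacity P2) <= capacity P2.
    by rewrite ge_min lexx orbT.
  lra.
rewrite -half /capacity -!mulrDl !ltr_pM2r ?invr_gt0 ?ln2_gt0 //.
rewrite -!lnM ?posrE; [|lra..].
rewrite ltr_ln ?posrE ?mulr_gt0 //; [|lra..].
have -> : (1 + P2) * (1 + P1 / (1 + P2)) = 1 + P2 + P1.
  by field; rewrite gt_eqF //; lra.
by lra.
Qed.

Lemma compression_noise_small {R : realType} (a p s : R) :
  0 < a < 1 -> 0 <= p -> 0 < s ->
  exists M : R, forall Q, M < Q -> exists s2, [/\ 0 < s2, s2 <= s &
    a * capacity ((p + 1) / s2) = (1 - a) * capacity (Q / (1 - a))].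
Proof.
move=> /andP[a0 a1] p0 s0.
have b0 : 0 < 1 - a by lra.
pose e := (1 - a) / a; have e0 : 0 < e by rewrite divr_gt0.
(* This threshold forces [e * L >= (p + 1) / s], with [L] as below. *)
exists ((1 - a) * expR ((p + 1) / (e * s))) => Q MQ.
set L := ln (1 + Q / (1 - a)).
have QL : expR ((p + 1) / (e * s)) < Q / (1 - a).
  by rewrite ltr_pdivlMr // mulrC.
have Lge : (p + 1) / (e * s) <= L.
  have ex0 := expR_gt0 ((p + 1) / (e * s)).
  by rewrite -[X in X <= _]expRK ler_ln ?posrE //; lra.
have eLge : (p + 1) / s <= e * L.
  have -> : (p + 1) / s = e * ((p + 1) / (e * s)) by field; rewrite !gt_eqF.
  by rewrite ler_pM2l.
have eL0 : 0 < e * L by apply: lt_le_trans eLge; rewrite divr_gt0 //; lra.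
have expge := expR_ge1Dx (e * L).
(* The rate equation reads [ln (1 + (p + 1) / s2) = e * L], solved here for [s2]; then
   [expR x - 1 >= x] gives [s2 <= s]. *)
exists ((p + 1) / (expR (e * L) - 1)); split.
- by rewrite divr_gt0 //; lra.
- rewrite ler_pdivrMr; last lra.
  have : p + 1 <= s * (e * L) by rewrite mulrC -ler_pdivrMr.
  by move=> /le_trans; apply; rewrite ler_pM2l //; lra.
- have -> : (p + 1) / ((p + 1) / (expR (e * L) - 1)) = expR (e * L) - 1.
    by field; rewrite !gt_eqF //; lra.
  rewrite /capacity addrC subrK expRK -/L /e.
  by field; rewrite !gt_eqF // ln2_gt0.
Qed.

(** The linear bound on [capacity p] turns the factor [a] into [a * p <= Ps]. *)
Lemma cf_rates_has_ubound {R : realType} (Ps Pj Q : R) :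
  0 <= Pj -> has_ubound (cf_rates Ps Pj Q).
Proof.
move=> Pj0; exists (Ps / ln 2 / 2) => _ [a [p [s [/andP[a0 a1] /andP[p0 ple]
  s0 _ ->]]]].
have ap : a * p <= Ps by rewrite mulrC -ler_pdivlMr.
have cj : 0 <= capacity (p / (1 + Pj / a)).
  by rewrite capacity_ge0 // divr_ge0 // addr_ge0 // divr_ge0 // ltW.
have cp : capacity (p / (1 + s)) <= capacity p.
  rewrite le_capacity ?divr_ge0 //; [lra|].
  by rewrite ler_pdivrMr ?ler_peMr //; lra.
have cl := capacity_le_linear p0.
have cp0 := capacity_ge0 p0.
have le_pos : pos_part (capacity (p / (1 + s)) - capacity (p / (1 + Pj / a)))
    <= p / ln 2 / 2.
  by rewrite ge_max; apply/andP; split; lra.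
apply: le_trans (ler_wpM2l (ltW a0) le_pos) _.
by rewrite !mulrA !ler_pM2r ?invr_gt0 ?ln2_gt0.
Qed.

(** Transmitting at [Ps], within the budget [Ps / a], against jamming [Pj / a >= Pj] costs only the
    factor [a] and the noise loss; both are fixed before [Q]. *)
Lemma cf_rate_ge {R : realType} (Ps Pj c : R) : 0 < Ps -> 0 <= Pj ->
  c < capacity Ps - capacity (Ps / (1 + Pj)) ->
  exists M : R, forall Q, M < Q -> c <= cf_rate Ps Pj Q.
Proof.
move=> Ps0 Pj0 cD; set D := capacity Ps - capacity (Ps / (1 + Pj)) in cD.
have D0 : 0 <= D.
  rewrite subr_ge0 le_capacity ?divr_ge0 ?ler_pdivrMr ?ler_peMr //; lra.
have l2 : 0 < ln 2 :> R := ln2_gt0.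
have [a [/andP[a0 a1] s0]] : exists a : R, 0 < a < 1 /\
    exists2 s : R, 0 < s & c <= a * (D - s / ln 2 / 2).
  (* A negative target does occur, for small powers; here the bound becomes
     [(D + c / 2) / 2 >= c]. *)
  have [c0|c0] := ltP c 0.
    exists 2^-1; split; first lra.
    exists (- c * ln 2); first by rewrite mulr_gt0 // oppr_gt0.
    by rewrite mulfK ?gt_eqF //; lra.
  (* [c <= c' < D' < D] with [c' > 0], so that [a * D' = c'] *)
  pose c' := (c + c + c + D) / 4; pose D' := (c + D) / 2.
  have c'0 : 0 < c' by rewrite /c'; lra.
  have D'0 : 0 < D' by rewrite /D'; lra.
  exists (c' / D'); split.
    by rewrite divr_gt0 //= ltr_pdivrMr // /c' /D'; lra.
  (* The noise loss [s / ln 2 / 2] is then exactly [D - D']. *)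
  exists ((D - D') * 2 * ln 2); first by rewrite !mulr_gt0 // /D'; lra.
  rewrite mulfK ?gt_eqF // mulfK ?gt_eqF // opprB addrC subrK divfK ?gt_eqF //.
  by rewrite /c'; lra.
case: s0 => s s0 cle.
have [M HM] := @compression_noise_small R a Ps s ltac:(lra) (ltW Ps0) s0.
exists M => Q /HM[s2 [s20 s2s eqs]].
apply: (le_trans cle).
apply: (@le_trans _ _ (a * pos_part (capacity (Ps / (1 + s2)) -
                              capacity (Ps / (1 + Pj / a))))).
  rewrite ler_pM2l // le_max; apply/orP; left.
  have Pja : Pj <= Pj / a by rewrite ler_pdivlMr // ler_piMr // ltW.
  have h1 : capacity (Ps / (1 + Pj / a)) <= capacity (Ps / (1 + Pj)).
    rewrite le_capacity ?divr_ge0 //; [lra..|lra|].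
    by rewrite ler_pM2l // lef_pV2 ?posrE; lra.
  have h2 := capacity_shrink_ge (ltW Ps0) (ltW s20).
  have h3 : s2 / ln 2 / 2 <= s / ln 2 / 2 by rewrite !ler_pM2r // invr_gt0.
  by rewrite /D; lra.
apply: ub_le_sup; first exact: cf_rates_has_ubound.
exists a, Ps, s2; split => //; first by rewrite a0.
by rewrite ltW //= ler_pdivlMr // ler_piMr // ltW.
Qed.

(** The corner [(r1, 0)] suffices, as [cooperative_jamming_gap] covers both orders of [P1] and
    [P2]. *)
Lemma sum_rate_inner_region_ge {R : realType} (P1 P2 h Pr : R) :
  ((cf_rate P1 P2 Pr)%:E <= sum_rate (inner_region P1 P2 h Pr))%E.
Proof.
apply: ereal_sup_ubound; exists (cf_rate P1 P2 Pr, 0); last by rewrite /= addr0.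
by move=> A [_]; apply; left; right.
Qed.

Theorem corollary3 (R : realType) (P1 P2 h : R)
    (hP1 : 0 < P1) (hP2 : 0 < P2) (hh : 0 < h) :
  (limf_esup (fun Pr : R => sum_rate (outer_region P1 P2 h Pr)
                            - sum_rate (inner_region P1 P2 h Pr)) (+oo)%R
   <= (2^-1 : R)%:E)%E.
Proof.
have [M HM] := cf_rate_ge hP1 (ltW hP2) (cooperative_jamming_gap hP1 hP2).
have Moo : (+oo)%R [set Pr : R | M < Pr] by exists M; split=> //; exact: num_real.
(* The upper limit is an infimum of suprema over neighbourhoods of [+oo], so the single one [M < Pr]
   bounds it. *)
rewrite limf_esupE; apply: le_trans (ereal_inf_lbound (imageP _ Moo)) _.
apply/ereal_supP => _ [Pr MPr <-].
apply: le_trans (leeB (sum_rate_outer_region_le h Pr (ltW hP1) (ltW hP2))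
                      (sum_rate_inner_region_ge P1 P2 h Pr)) _.
by rewrite -EFinB lee_fin; have := HM _ MPr; lra.
Qed.
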